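(* Let $(M,\mathcal Q)$ be an almost quaternionic manifold and let $\nabla$ and $\nabla'$ be two different quaternionic connections on it. Put $S=\nabla'-\nabla$ and, for a local admissible basis $(J_1,J_2,J_3)$ of $\mathcal Q$, let $s^1,s^2,s^3$ be the local 1-forms determined by the splitting $$S_X(Y)=S^0_X(Y)+s^1(X)J_1Y+s^2(X)J_2Y+s^3(X)J_3Y,\qquad [S^0_X,J_i]=0,\ i=1,2,3.$$ The following conditions are equivalent: (i) the two almost complex structures $I_2^{\nabla}$ and $I_2^{\nabla'}$ on the twistor space $Z$ coincide; (ii) for every local admissible basis of $\mathcal Q$ the 1-forms $s^1,s^2,s^3$ vanish identically, $s^1=s^2=s^3=0$.
   Context: An almost quaternionic structure on a $4n$-dimensional manifold $M$ ($n\ge 1$) is a rank-3 subbundle $\mathcal Q\subset \mathrm{End}(TM)$ which is locally spanned by triples $(J_1,J_2,J_3)$ of almost complex structures with $J_\alpha^2=-\mathrm{id}$ and $J_1J_2=-J_2J_1=J_3$; such a local triple is called an admissible basis of $\mathcal Q$. $(M,\mathcal Q)$ is then called an almost quaternionic manifold. A quaternionic connection is a linear connection $\nabla$ on $TM$ preserving $\mathcal Q$, i.e. $\nabla_X\sigma\in\Gamma(\mathcal Q)$ for every vector field $X$ and every $\sigma\in\Gamma(\mathcal Q)$; no assumption is made on its torsion. For two quaternionic connections $\nabla,\nabla'$ one writes $\nabla'_X=\nabla_X+S_X$; then each endomorphism $S_X$ splits uniquely as the sum of an endomorphism $S^0_X$ commuting with $J_1,J_2,J_3$ and a linear combination of $J_1,J_2,J_3$.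 Twistor space: $Z=\{J\in\mathcal Q: J^2=-\mathrm{id}\}$, i.e. the $S^2$-bundle $\pi:Z\to M$ whose elements are locally $J=a_1J_1+a_2J_2+a_3J_3$ with $a_1^2+a_2^2+a_3^2=1$. For $J\in Z$ with $\pi(J)=x$, the vertical space is $V_J=\ker \pi_{*}=\{W\in\mathcal Q_x: WJ+JW=0\}$. A quaternionic connection $\nabla$ induces a connection on the vector bundle $\mathcal Q$ which preserves $Z$, hence a horizontal distribution $H$ on $Z$ with $T_JZ=V_J\oplus H_J$ and $\pi_*:H_J\to T_xM$ an isomorphism. For $Y\in T_xM$ let $Y^h\in H_J$ denote its horizontal lift. The almost complex structure $I_2^\nabla$ on $Z$ is defined at $J\in Z$ by $I_2^\nabla(W)=-JW$ for $W\in V_J$ and $I_2^\nabla(Y^h)=(JY)^h$ for $Y\in T_xM$. *)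

(* Defs.v *)
From HB Require Import structures.
From mathcomp Require Import all_boot all_order all_algebra.
From mathcomp Require Import all_classical all_reals all_analysis.

Set Implicit Arguments.
Unset Strict Implicit.
Unset Printing Implicit Defensive.

Import Order.TTheory GRing.Theory Num.Theory.
Import numFieldNormedType.Exports.

Local Open Scope classical_set_scope.
Local Open Scope ring_scope.

Section Smooth.
Variables (R : realType) (V W : normedModType R).

(* Meant for finite-dimensional V and open U: there, the differential
   x |-> 'd f x is of class C^k iff x |-> 'd f x v is so for every v. *)
Fixpoint Ck_on (k : nat) (U : set V) (f : V -> W) : Prop :=
  if k is k'.+1 then
    (forall x, U x -> differentiable f x) /\
    (forall v : V, Ck_on k' U (fun x => 'd f x v))
  else forall x, U x -> {for x, continuous f}.

Definition smooth_on (U : set V) (f : V -> W) : Prop :=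
  forall k, Ck_on k U f.

End Smooth.

(* A smooth manifold of dimension m given by an atlas; [chart i] is only
   meaningful on [cdom i], and [cinv i] on the open set [chart i @` cdom i].
   [chart_at x] selects a chart around x. It serves to represent T_x M as
   'cV[R]_m: a tangent vector at x is identified with its coordinates in the
   chart [chart_at x], and an endomorphism of T_x M with an m x m matrix. *)
Record manifold (R : realType) (m : nat) := Manifold {
  carrier :> topologicalType;
  hausdorff_carrier : hausdorff_space carrier;
  second_countable_carrier : @second_countable carrier;
  cindex : Type;
  cdom : cindex -> set carrier;
  chart : cindex -> carrier -> 'cV[R]_m;
  cinv : cindex -> 'cV[R]_m -> carrier;
  open_cdom : forall i, open (cdom i);
  open_cimage : forall i, open (chart i @` cdom i);
  chartK : forall i x, cdom i x -> cinv i (chart i x) = x;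
  chart_continuous : forall i x, cdom i x -> {for x, continuous (chart i)};
  cinv_continuous : forall i p, (chart i @` cdom i) p ->
    {for p, continuous (cinv i)};
  transition_smooth : forall i j,
    smooth_on (chart i @` (cdom i `&` cdom j)) (chart j \o cinv i);
  chart_at : carrier -> cindex;
  chart_atP : forall x, cdom (chart_at x) x
}.

Section Manifolds.
Variables (R : realType) (m : nat) (M : manifold R m).

Local Notation vector := 'cV[R]_m.
Local Notation endo := 'M[R]_m.

Definition jacobian_mx (f : vector -> vector) (p : vector) : endo :=
  \matrix_(k, l) ('d f p (delta_mx l 0 : vector)) k 0.

(* Converts vectors of T_x M, i.e. coordinates in the chart [chart_at x],
   to coordinates in the chart i. *)
Definition tchange (i : cindex M) (x : M) : endo :=
  jacobian_mx (chart i \o cinv (chart_at x)) (chart (chart_at x) x).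

Definition vec_coord (i : cindex M) (X : M -> vector) (x : M) : vector :=
  tchange i x *m X x.

Definition endo_coord (i : cindex M) (A : M -> endo) (x : M) : endo :=
  tchange i x *m A x *m invmx (tchange i x).

(* Fields and sections on an open set U are total functions whose values
   outside U are irrelevant. *)
Definition smooth_map (W : normedModType R) (U : set M) (F : M -> W) : Prop :=
  forall i, smooth_on (chart i @` (U `&` cdom i)) (F \o cinv i).

Definition smooth_vf (U : set M) (X : M -> vector) : Prop :=
  forall i, smooth_on (chart i @` (U `&` cdom i)) (vec_coord i X \o cinv i).

Definition smooth_ef (U : set M) (A : M -> endo) : Prop :=
  forall i, smooth_on (chart i @` (U `&` cdom i)) (endo_coord i A \o cinv i).

(* The derivative v(F) of F along v in T_x M. *)
Definition dirder (W : normedModType R) (F : M -> W) (x : M) (v : vector) : W :=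
  'D_v (F \o cinv (chart_at x)) (chart (chart_at x) x).

(* A linear connection on TM, acting on local vector fields:
   [cov D Y x v] is D_v Y in T_x M, for v in T_x M and Y a vector field which
   is smooth around x. *)
Record connection := Connection {
  cov : (M -> vector) -> M -> vector -> vector;
  cov_local : forall (U : set M) (Y Y' : M -> vector) x v, open U -> U x ->
    smooth_vf U Y -> smooth_vf U Y' -> (forall y, U y -> Y y = Y' y) ->
    cov Y x v = cov Y' x v;
  cov_linear : forall (U : set M) (Y : M -> vector) x (a : R) v w,
    open U -> U x -> smooth_vf U Y ->
    cov Y x (a *: v + w) = a *: cov Y x v + cov Y x w;
  cov_add : forall (U : set M) (Y Y' : M -> vector) x v, open U -> U x ->
    smooth_vf U Y -> smooth_vf U Y' ->
    cov (fun y => Y y + Y' y) x v = cov Y x v + cov Y' x v;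
  cov_leibniz : forall (U : set M) (f : M -> R) (Y : M -> vector) x v,
    open U -> U x -> smooth_map U f -> smooth_vf U Y ->
    cov (fun y => f y *: Y y) x v = dirder f x v *: Y x + f x *: cov Y x v;
  cov_smooth : forall (U : set M) (X Y : M -> vector), open U ->
    smooth_vf U X -> smooth_vf U Y ->
    smooth_vf U (fun y => cov Y y (X y))
}.

(* Values of [cov] on fields that are not smooth carry no meaning, so two
   connections are different when they differ on some smooth local field. *)
Definition connections_differ (D D' : connection) : Prop :=
  exists (U : set M) (Y : M -> vector) (x : M) (v : vector),
    [/\ open U, U x, smooth_vf U Y & cov D Y x v <> cov D' Y x v].

(* A = D_v sigma in End(T_x M), for the connection induced by D on End(TM). *)
Definition cov_endo (D : connection) (sigma : M -> endo) (x : M) (v : vector)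
    (A : endo) : Prop :=
  forall (U : set M) (Y : M -> vector), open U -> U x -> smooth_vf U Y ->
    A *m Y x = cov D (fun y => sigma y *m Y y) x v - sigma x *m cov D Y x v.

Definition endo_family := M -> set endo.

Definition admissible_basis (Q : endo_family) (U : set M)
    (J1 J2 J3 : M -> endo) : Prop :=
  [/\ open U,
      [/\ smooth_ef U J1, smooth_ef U J2 & smooth_ef U J3],
      forall x, U x ->
        [/\ J1 x *m J1 x = - 1%:M, J2 x *m J2 x = - 1%:M &
            J3 x *m J3 x = - 1%:M],
      forall x, U x ->
        J1 x *m J2 x = J3 x /\ - (J2 x *m J1 x) = J3 x &
      forall x, U x ->
        Q x = [set A | exists a1 a2 a3 : R,
                         A = a1 *: J1 x + a2 *: J2 x + a3 *: J3 x]].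

(* The rank of Q is automatically 3, since id, J1, J2, J3 are linearly
   independent as soon as m > 0. *)
Definition almost_quaternionic (Q : endo_family) : Prop :=
  forall x, exists (U : set M) (J1 J2 J3 : M -> endo),
    U x /\ admissible_basis Q U J1 J2 J3.

Definition section_of (Q : endo_family) (U : set M) (sigma : M -> endo) : Prop :=
  smooth_ef U sigma /\ forall y, U y -> Q y (sigma y).

Definition quaternionic (Q : endo_family) (D : connection) : Prop :=
  forall (U : set M) (sigma : M -> endo), open U -> section_of Q U sigma ->
    forall x v, U x -> exists2 A, cov_endo D sigma x v A & Q x A.

Definition twistor (Q : endo_family) (x : M) (J : endo) : Prop :=
  Q x J /\ J *m J = - 1%:M.

(* The tangent space at (x, J) of the total space of End(TM): the chart
   [chart_at x] of M induces the chart
     (y, A) |-> (chart (chart_at x) y, coordinates of A)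
   of the total space, and a tangent vector at (x, J) is represented by its
   coordinates in that chart. The differential of the projection to M is then
   fst, and W in End(T_x M), viewed as a vertical vector, is (0, W). *)
Local Notation tangent := ('cV[R]_m * 'M[R]_m)%type.

(* sigma_* v, tangent to the total space of End(TM) at (x, sigma x). *)
Definition section_push (sigma : M -> endo) (x : M) (v : vector) : tangent :=
  (v, dirder (endo_coord (chart_at x) sigma) x v).

(* T_J Z: the velocities at t = 0 of the smooth curves t |-> (g t, A t) in Z
   with (g 0, A 0) = (x, J). *)
Definition twistor_tangent (Q : endo_family) (x : M) (J : endo) : set tangent :=
  [set xi | exists (e : R) (g : R -> M) (A : R -> endo)
                   (p : R -> vector) (B : R -> endo),
    [/\ 0 < e,
        forall t, ball (0 : R) e t ->
          [/\ cdom (chart_at x) (g t), twistor Q (g t) (A t),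
              p t = chart (chart_at x) (g t) &
              B t = endo_coord (chart_at x) (fun=> A t) (g t)],
        smooth_on (ball (0 : R) e) p /\ smooth_on (ball (0 : R) e) B,
        g 0 = x /\ A 0 = J &
        xi = ('D_1 p 0, 'D_1 B 0)]].

Definition vertical (Q : endo_family) (x : M) (J : endo) : set endo :=
  [set W | Q x W /\ W *m J + J *m W = 0].

(* H_J: the vectors sigma_* v, for sigma a local section of Q through J with
   D_v sigma = 0. *)
Definition horizontal (Q : endo_family) (D : connection) (x : M) (J : endo) :
    set tangent :=
  [set xi | exists (U : set M) (sigma : M -> endo),
    [/\ open U /\ U x, section_of Q U sigma, sigma x = J,
        cov_endo D sigma x xi.1 0 & xi = section_push sigma x xi.1]].

(* The horizontal lift Y^h in H_J: the unique element of H_J over Y. *)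
Definition hlift (Q : endo_family) (D : connection) (x : M) (J : endo)
    (Y : vector) : tangent :=
  xget 0 [set xi | horizontal Q D x J xi /\ xi.1 = Y].

(* The value at xi = W + Y^h, with W in V_J, is - J W + (J Y)^h; only used for
   xi in T_J Z = V_J (+) H_J, where such a decomposition exists uniquely. *)
Definition I2 (Q : endo_family) (D : connection) (x : M) (J : endo)
    (xi : tangent) : tangent :=
  xget 0 [set eta | exists (W : endo) (Y : vector),
    [/\ vertical Q x J W,
        xi = (0, W) + hlift Q D x J Y &
        eta = (0, - (J *m W)) + hlift Q D x J (J *m Y)]].

(* s1, s2, s3 (together with S0) give the splitting over U of S = D' - D with
   respect to (J1, J2, J3). S_v is tensorial, so it is tested on local fields. *)
Definition splitting (D D' : connection) (U : set M) (J1 J2 J3 : M -> endo)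
    (S0 : M -> vector -> endo) (s1 s2 s3 : M -> vector -> R) : Prop :=
  forall x v, U x ->
    [/\ S0 x v *m J1 x = J1 x *m S0 x v,
        S0 x v *m J2 x = J2 x *m S0 x v,
        S0 x v *m J3 x = J3 x *m S0 x v &
        forall (O : set M) (Y : M -> vector), open O -> O x -> smooth_vf O Y ->
          cov D' Y x v - cov D Y x v =
            S0 x v *m Y x + s1 x v *: (J1 x *m Y x)
              + s2 x v *: (J2 x *m Y x) + s3 x v *: (J3 x *m Y x)].

End Manifolds.

(* Main.v *)
Require Import Defs.
From mathcomp Require Import all_boot all_order all_algebra.
From mathcomp Require Import all_classical all_reals all_analysis.
From mathcomp Require Import ring lra.

Set Implicit Arguments.
Unset Strict Implicit.
Unset Printing Implicit Defensive.

Import Order.TTheory GRing.Theory Num.Theory.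
Import numFieldNormedType.Exports.

Local Open Scope classical_set_scope.
Local Open Scope ring_scope.

(** Everything reduces to the matrices of the connections at one point. In the
    coordinate frame of the chart at [x] a connection [D] is a family of
    matrices [G v], linked to it by [D_v Y = d_v Y + G v Y] on vector fields
    ([cov_coordE]), hence by [D_v A = d_v A + (G v A - A G v)] on fields of
    endomorphisms ([cov_endoP]). The difference of two connections is therefore
    the endomorphism [S_v = G' v - G v], and the horizontal lift of [Y] at [J]
    is [(Y, - (G Y J - J G Y))] ([hliftE]); the latter needs a section of [Q]
    through [J] which is parallel along [Y], built in [exists_parallel].

    If the two structures coincide, evaluate them on the velocity of the
    section [J1] of an admissible basis along a vector [Y]. This section takes
    its values in the twistor space, so the velocity is tangent to it; it is
    [Y^h + D_Y J1] for the first connection and [Y^h' + D'_Y J1] for the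
    second. Writing [c(S)] for the commutator of [S] with [J = J1 x], the two
    values of [I_2] agree exactly when [c(S_(JY)) + J c(S_Y) = 0]
    ([I2_relation]). Only the parts [s2 J2 + s3 J3] of the endomorphisms
    contribute, and the relation reads [s2 (J1 Y) = s3 Y] and
    [s3 (J1 Y) = - s2 Y] ([I2_splitting_relation]). Permuting the basis
    cyclically,
    [s1 Y = s3 (J2 Y) = s2 (J1 J2 Y) = s2 (J3 Y) = - s1 Y], so [s1 = 0], and
    [s2], [s3] follow.

    Conversely, both connections preserve [Q], so the commutators of [S_v] with
    [J1], [J2], [J3] lie in [Q]; averaging over the quaternion group then
    produces a splitting of [S] ([quaternion_splitting], [exists_splitting]),
    to which the vanishing hypothesis applies. It says that [S_v] commutes with
    [Q]; the two connections then have the same derivatives on sections of [Q],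
    hence the same horizontal spaces ([horizontal_eq]) and the same [I_2].

    The analytic part serves to make the coordinate frame of a chart a smooth
    local frame, that is, to differentiate jacobians of transition maps and to
    compose them with other transition maps. *)

(** * Differentials and functions of class C^k *)

Section Differentials.
Variables (R : realType) (V W : normedModType R).
Implicit Types f g : V -> W.

(** The difference [g - f] vanishes near [x], so it is differentiable with
    zero differential, and [g] is the sum of [f] and [g - f]. *)
Lemma near_eq_is_diff f g x : (\near x, f x = g x) -> differentiable f x ->
  is_diff x g ('d f x).
Proof.
move=> fg df.
have fgx : f x = g x := nbhs_singleton fg.
have d0 : (g - f) \o shift x = cst ((g - f) x) + (\0 : V -> W) +o_ 0 id.
  apply/eqaddoP => _/posnumP[e].
  move: fg; rewrite (near_shift 0) subr0 => fg.
  near=> h.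
  have fgh : f (h + x) = g (h + x) by near: h.
  rewrite /= /shift /cst [X in `|X|](_ : _ = 0) ?normr0 //.
  rewrite -[LHS]/(g (h + x) - f (h + x) - (g x - f x + 0)).
  by rewrite fgh fgx !subrr addr0 subrr.
have dgf0 : 'd (g - f) x = \0 :> (V -> W).
  by apply: diff_unique => // ?; exact: cvg_cst.
have dgf : is_diff x (g - f) 0.
  apply: DiffDef => //; apply/diff_locallyP; rewrite dgf0; split => //.
  by move=> ?; exact: cvg_cst.
have -> : g = f + (g - f) by rewrite addrC subrK.
have dfx := differentiableP df.
by have := @is_diffD _ _ _ _ _ _ _ _ dfx dgf; rewrite addr0.
Unshelve. all: by end_near. Qed.

Lemma is_diff_coord m n (F : V -> 'M[R]_(m, n)) x i j : differentiable F x ->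
  is_diff x (fun x => F x i j) (fun v => 'd F x v i j).
Proof.
move=> dF.
have dFij : differentiable (fun x => F x i j) x.
  exact: differentiable_comp dF (differentiable_coord _ i j).
apply: DiffDef => //; apply/funext => v.
rewrite -(deriveE v dFij) -(deriveE v dF).
by rewrite (derive_mx (diff_derivable dF)) mxE.
Qed.

End Differentials.

Section Ck.
Variables (R : realType) (V : normedModType R).
Implicit Types (U : set V) (k : nat).

Lemma Ck_onW (W : normedModType R) k U (f : V -> W) :
  Ck_on k.+1 U f -> Ck_on k U f.
Proof.
elim: k f => [|k IH] f.
  by move=> [df _] x Ux; exact: differentiable_continuous (df x Ux).
by case=> df Cf; split => // v; exact: IH (Cf v).
Qed.

Lemma Ck_on_subset (W : normedModType R) k U U' (f : V -> W) :
  U' `<=` U -> Ck_on k U f -> Ck_on k U' f.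
Proof.
move=> UU'; elim: k f => [|k IH] f.
  by move=> Cf x Ux; exact: Cf (UU' _ Ux).
by case=> df Cf; split=> [x Ux|v]; [exact: df (UU' _ Ux)|exact: IH (Cf v)].
Qed.

Lemma Ck_on_ext (W : normedModType R) k U (f g : V -> W) : open U ->
  (forall x, U x -> f x = g x) -> Ck_on k U f -> Ck_on k U g.
Proof.
move=> oU; elim: k f g => [|k IH] f g fg.
  move=> Cf x Ux; rewrite /prop_for /continuous_at -(fg x Ux).
  apply: cvg_trans (Cf x Ux); apply: near_eq_cvg.
  exact: (filterS fg (open_nbhs_nbhs (conj oU Ux))).
have dg x : U x -> differentiable f x -> is_diff x g ('d f x).
  move=> Ux; apply: near_eq_is_diff.
  exact: (filterS fg (open_nbhs_nbhs (conj oU Ux))).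
case=> df Cf; split=> [x Ux|v]; first by have [] := dg x Ux (df x Ux).
apply: IH (Cf v) => x Ux.
by have [_ ->] := dg x Ux (df x Ux).
Qed.

Lemma Ck_on_cst (W : normedModType R) k U (w : W) : Ck_on k U (cst w).
Proof.
elim: k w => [|k IH] w; first by move=> x _; exact: cst_continuous.
split=> [x _|v]; first exact: differentiable_cst.
have -> : (fun x => 'd (cst w) x v) = cst (0 : W).
  by apply/funext => x; rewrite diff_cst.
exact: IH.
Qed.

Lemma Ck_onD (W : normedModType R) k U (f g : V -> W) : open U ->
  Ck_on k U f -> Ck_on k U g -> Ck_on k U (fun x => f x + g x).
Proof.
move=> oU; elim: k f g => [|k IH] f g.
  by move=> Cf Cg x Ux; apply: cvgD; [exact: Cf|exact: Cg].
case=> df Cf [dg Cg]; split=> [x Ux|v].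
  by apply: differentiableD; [exact: df|exact: dg].
apply: Ck_on_ext (IH _ _ (Cf v) (Cg v)) => // x Ux.
exact: esym (congr1 (@^~ v) (diffD (df _ Ux) (dg _ Ux))).
Qed.

Lemma Ck_on_sum (W : normedModType R) k U (I : Type) (r : seq I)
    (f : I -> V -> W) : open U ->
  (forall i, Ck_on k U (f i)) -> Ck_on k U (fun x => \sum_(i <- r) f i x).
Proof.
move=> oU Cf; elim: r => [|i r IH].
  by under eq_fun do rewrite big_nil; exact: Ck_on_cst.
by under eq_fun do rewrite big_cons; exact: Ck_onD.
Qed.

Lemma Ck_onM k U (f g : V -> R) : open U ->
  Ck_on k U f -> Ck_on k U g -> Ck_on k U (fun x => f x * g x).
Proof.
move=> oU; elim: k f g => [|k IH] f g.
  by move=> Cf Cg x Ux; apply: cvgM; [exact: Cf|exact: Cg].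
move=> Cf Cg; have Cf' := Ck_onW Cf; have Cg' := Ck_onW Cg.
case: Cf Cg => df Cf [dg Cg]; split=> [x Ux|v].
  by apply: differentiableM; [exact: df|exact: dg].
apply: Ck_on_ext (Ck_onD oU (IH _ _ Cf' (Cg v)) (IH _ _ Cg' (Cf v))) => // x Ux.
exact: esym (congr1 (@^~ v) (diffM (df _ Ux) (dg _ Ux))).
Qed.

Lemma Ck_onZl (W : normedModType R) k U (f : V -> R) (w : W) : open U ->
  Ck_on k U f -> Ck_on k U (fun x => f x *: w).
Proof.
move=> oU; elim: k f => [|k IH] f.
  by move=> Cf x Ux; apply: cvgZr_tmp; exact: Cf.
case=> df Cf; split=> [x Ux|v]; first exact: differentiableZl (df x Ux).
apply: Ck_on_ext (IH _ (Cf v)) => // x Ux.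
exact: esym (congr1 (@^~ v) (diffZl w (df x Ux))).
Qed.

Lemma Ck_on_coord k U m n (F : V -> 'M[R]_(m, n)) i j : open U ->
  Ck_on k U F -> Ck_on k U (fun x => F x i j).
Proof.
move=> oU; elim: k F => [|k IH] F.
  move=> CF x Ux; apply: (@continuous_comp _ _ _ F (fun M => M i j)).
    exact: CF.
  exact: coord_continuous.
case=> dF CF; split=> [x Ux|v].
  by have [] := is_diff_coord i j (dF x Ux).
apply: Ck_on_ext (IH _ (CF v)) => // x Ux.
by have [_ ->] := is_diff_coord i j (dF x Ux).
Qed.

Lemma Ck_on_mx k U m n (F : V -> 'M[R]_(m, n)) : open U ->
  (forall i j, Ck_on k U (fun x => F x i j)) -> Ck_on k U F.
Proof.
move=> oU CF.
have -> : F = fun x => \sum_i \sum_j F x i j *: (delta_mx i j : 'M[R]_(m, n)).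
  by apply/funext => x; exact: matrix_sum_delta.
by do 2!(apply: Ck_on_sum => // ?); exact: Ck_onZl.
Qed.

(** The derivative of [f \o g] in the direction [v] is the sum over [l] of
    [('d g x v)_l * 'd f (g x) e_l]: expanding the inner derivative in
    coordinates is what makes the induction on the order of
    differentiability go through with directional derivatives only. *)
Lemma Ck_on_comp k U m (U' : set 'cV[R]_m) (f : 'cV[R]_m -> R)
    (g : V -> 'cV[R]_m) : open U ->
  (forall x, U x -> U' (g x)) -> Ck_on k U' f -> Ck_on k U g ->
  Ck_on k U (f \o g).
Proof.
move=> oU UU'; elim: k f g UU' => [|k IH] f g UU'.
  by move=> Cf Cg x Ux; apply: continuous_comp; [exact: Cg|exact/Cf/UU'].
move=> Cf Cg; have Cg' := Ck_onW Cg.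
case: Cf Cg => df Cf [dg Cg]; split=> [x Ux|v].
  by apply: differentiable_comp; [exact: dg|exact/df/UU'].
have C : Ck_on k U (fun x => \sum_(l < m) 'd g x v l 0 *
    ((fun y => 'd f y (delta_mx l 0 : 'cV[R]_m)) \o g) x).
  apply: Ck_on_sum => // l; apply: Ck_onM => //.
    exact: Ck_on_coord (Cg v).
  exact: IH UU' (Cf (delta_mx l 0)) Cg'.
apply: Ck_on_ext C => // x Ux.
rewrite (diff_comp (dg x Ux) (df _ (UU' _ Ux))) /=.
rewrite [in RHS](matrix_sum_delta ('d g x v)) linear_sum.
by apply: eq_bigr => l _; rewrite big_ord1 linearZ.
Qed.

End Ck.

(** * Smooth functions *)

Section SmoothFunctions.
Variables (R : realType) (V : normedModType R) (U : set V).
Hypothesis oU : open U.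

Lemma smooth_on_differentiable (W : normedModType R) (f : V -> W) x :
  smooth_on U f -> U x -> differentiable f x.
Proof. by move=> Cf; have [df _] := Cf 1%N; exact: df. Qed.

Lemma smooth_on_diff (W : normedModType R) (f : V -> W) v :
  smooth_on U f -> smooth_on U (fun x => 'd f x v).
Proof. by move=> Cf k; have [_ Cd] := Cf k.+1; exact: Cd. Qed.

Lemma smooth_on_ext (W : normedModType R) (f g : V -> W) :
  (forall x, U x -> f x = g x) -> smooth_on U f -> smooth_on U g.
Proof. by move=> fg Cf k; exact: Ck_on_ext fg (Cf k). Qed.

Lemma smooth_on_mx m n (F : V -> 'M[R]_(m, n)) :
  (forall i j, smooth_on U (fun x => F x i j)) -> smooth_on U F.
Proof. by move=> CF k; apply: Ck_on_mx => // i j; exact: CF. Qed.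

Lemma smooth_on_coord m n (F : V -> 'M[R]_(m, n)) i j :
  smooth_on U F -> smooth_on U (fun x => F x i j).
Proof. by move=> CF k; exact: Ck_on_coord (CF k). Qed.

Lemma smooth_onD (W : normedModType R) (f g : V -> W) :
  smooth_on U f -> smooth_on U g -> smooth_on U (fun x => f x + g x).
Proof. by move=> Cf Cg k; exact: Ck_onD. Qed.

Lemma smooth_on_mulmx m n p (F : V -> 'M[R]_(m, n)) (G : V -> 'M[R]_(n, p)) :
  smooth_on U F -> smooth_on U G -> smooth_on U (fun x => F x *m G x).
Proof.
move=> CF CG; apply: smooth_on_mx => i j k.
under eq_fun do rewrite mxE.
apply: Ck_on_sum => // l.
by apply: Ck_onM => //; apply: Ck_on_coord.
Qed.

Lemma smooth_on_scalemx m n (f : V -> R) (F : V -> 'M[R]_(m, n)) :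
  smooth_on U f -> smooth_on U F -> smooth_on U (fun x => f x *: F x).
Proof.
move=> Cf CF; apply: smooth_on_mx => i j k.
under eq_fun do rewrite mxE.
by apply: Ck_onM => //; exact: Ck_on_coord.
Qed.

Lemma smooth_on_comp l m n (U' : set 'cV[R]_l) (F : 'cV[R]_l -> 'M[R]_(m, n))
    (g : V -> 'cV[R]_l) : open U' ->
  (forall x, U x -> U' (g x)) -> smooth_on U' F -> smooth_on U g ->
  smooth_on U (F \o g).
Proof.
move=> oU' UU' CF Cg; apply: smooth_on_mx => i j k.
exact: Ck_on_comp oU UU' (Ck_on_coord i j oU' (CF k)) (Cg k).
Qed.

End SmoothFunctions.

(** * Jacobians of transition maps *)

Section Jacobians.
Variables (R : realType) (m : nat).
Implicit Types f g : 'cV[R]_m -> 'cV[R]_m.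

Lemma jacobian_mxE f p (v : 'cV[R]_m) : 'd f p v = jacobian_mx f p *m v.
Proof.
rewrite [in LHS](matrix_sum_delta v) linear_sum.
apply/colP => k; rewrite summxE mxE; apply: eq_bigr => l _.
by rewrite big_ord1 linearZ !mxE mulrC.
Qed.

Lemma jacobian_mx_comp f g p : differentiable f p -> differentiable g (f p) ->
  jacobian_mx (g \o f) p = jacobian_mx g (f p) *m jacobian_mx f p.
Proof.
move=> df dg; apply/matrixP => k l.
have e : 'd (g \o f) p (delta_mx l 0 : 'cV[R]_m) =
    jacobian_mx g (f p) *m 'd f p (delta_mx l 0 : 'cV[R]_m).
  rewrite -jacobian_mxE.
  have := congr1 (@^~ (delta_mx l 0 : 'cV[R]_m)) (diff_comp df dg).
  exact.
by rewrite mxE e (jacobian_mxE f) mulmxA -colE mxE.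
Qed.

Lemma near_eq_jacobian_mx f g p : (\near p, f p = g p) -> differentiable f p ->
  jacobian_mx g p = jacobian_mx f p.
Proof.
move=> fg df; have [_ e] := near_eq_is_diff fg df.
apply/matrixP => k l; rewrite [LHS]mxE [RHS]mxE.
by have := congr1 (fun h : 'cV[R]_m -> 'cV[R]_m => h (delta_mx l 0) k 0) e.
Qed.

Lemma jacobian_mx_id p : jacobian_mx id p = 1%:M :> 'M[R]_m.
Proof.
have [_ e] := is_diff_id p.
apply/matrixP => k l; rewrite [LHS]mxE.
have := congr1 (fun h : 'cV[R]_m -> 'cV[R]_m => h (delta_mx l 0) k 0) e.
by rewrite /= !mxE eqxx andbT => ->.
Qed.

Lemma smooth_on_jacobian_mx (U : set 'cV[R]_m) f : open U ->
  smooth_on U f -> smooth_on U (jacobian_mx f).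
Proof.
move=> oU Cf; apply: smooth_on_mx => // k l.
under eq_fun do rewrite mxE.
by apply: smooth_on_coord => //; exact: smooth_on_diff.
Qed.

End Jacobians.

Section Charts.
Variables (R : realType) (m : nat) (M : manifold R m).
Implicit Types (i j k : cindex M) (x y : M) (U : set M).

Local Notation transition i j := (chart j \o cinv i).

(** The inverse of the chart is continuous only on the image of the chart, so
    the openness of that image has to be used together with it. *)
Lemma near_cinv i U x : open U -> U x -> cdom i x ->
  \forall p \near chart i x, (chart i @` (U `&` cdom i)) p.
Proof.
move=> oU Ux ix.
have Vx : (chart i @` cdom i) (chart i x) by exists x.
have cx := cinv_continuous Vx; rewrite /prop_for /continuous_at (chartK ix) in cx.
have n1 := open_nbhs_nbhs (conj (@open_cimage _ _ M i) Vx).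
have n2 := cx _ (open_nbhs_nbhs (conj oU Ux)).
apply: filterS (filterI n1 n2) => p [[y iy <-]] /=.
by rewrite (chartK iy) => Uy; exists y.
Qed.

Lemma open_chart_image i U : open U -> open (chart i @` (U `&` cdom i)).
Proof.
move=> oU; rewrite openE => p [x [Ux ix] <-].
exact: near_cinv.
Qed.

Lemma near_chartK i x : cdom i x ->
  \forall p \near chart i x, chart i (cinv i p) = p.
Proof.
move=> ix; apply: filterS (near_cinv openT I ix) => p [y [_ iy] <-].
by rewrite (chartK iy).
Qed.

Lemma differentiable_transition i j x : cdom i x -> cdom j x ->
  differentiable (transition i j) (chart i x).
Proof.
move=> ix jx.
by apply: smooth_on_differentiable (@transition_smooth _ _ M i j) _; exists x.
Qed.

(** The chain rule for [chart k \o cinv i], which agrees near [chart i x] with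
    the composite of the transition maps through the chart [j]. *)
Lemma jacobian_transition_comp i j k x : cdom i x -> cdom j x -> cdom k x ->
  jacobian_mx (transition j k) (chart j x) *m
    jacobian_mx (transition i j) (chart i x) =
  jacobian_mx (transition i k) (chart i x).
Proof.
move=> ix jx kx.
have jE : chart j x = transition i j (chart i x) by rewrite /= (chartK ix).
rewrite [X in jacobian_mx _ X *m _]jE -jacobian_mx_comp; last 2 first.
- exact: differentiable_transition.
- by rewrite -jE; exact: differentiable_transition.
apply: near_eq_jacobian_mx; last exact: differentiable_transition.
apply: filterS (near_cinv (@open_cdom _ _ M j) jx ix) => p [y [jy iy] <-] /=.
by rewrite (chartK iy) (chartK jy).
Qed.

Lemma jacobian_transition_id i x : cdom i x ->
  jacobian_mx (transition i i) (chart i x) = 1%:M.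
Proof.
move=> ix; rewrite -(jacobian_mx_id (chart i x)).
apply: near_eq_jacobian_mx; last by have [] := is_diff_id (chart i x).
by apply: filterS (near_chartK ix) => p /= ->.
Qed.

Lemma tchange_chart_at x : tchange (chart_at x) x = 1%:M.
Proof. exact: jacobian_transition_id (chart_atP x). Qed.

Lemma tchange_transition i j x : cdom i x -> cdom j x ->
  tchange j x = jacobian_mx (transition i j) (chart i x) *m tchange i x.
Proof.
by move=> ix jx; rewrite jacobian_transition_comp //; exact: chart_atP.
Qed.

(** The jacobian of the transition map back to the chart [chart_at x] is an
    inverse. *)
Lemma tchange_unit i x : cdom i x -> tchange i x \in unitmx.
Proof.
move=> ix; have := tchange_transition ix (chart_atP x).
by rewrite tchange_chart_at => /esym /mulmx1_unit [].
Qed.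

End Charts.
Arguments open_chart_image [R m M] i [U].

(** * Smooth fields *)

Section Fields.
Variables (R : realType) (m : nat) (M : manifold R m).
Implicit Types (i j : cindex M) (x y : M) (U : set M).
Implicit Types (Y : M -> 'cV[R]_m) (A : M -> 'M[R]_m).

Local Notation transition i j := (chart j \o cinv i).

Lemma chart_image_subset i U U' : U' `<=` U ->
  chart i @` (U' `&` cdom i) `<=` chart i @` (U `&` cdom i).
Proof. by move=> UU' _ [y [Uy iy] <-]; exists y => //; split => //; exact: UU'. Qed.

Lemma smooth_vf_subset U U' Y : U' `<=` U -> smooth_vf U Y -> smooth_vf U' Y.
Proof.
by move=> UU' sY i k; exact: Ck_on_subset (chart_image_subset UU') (sY i k).
Qed.

Lemma smooth_ef_subset U U' A : U' `<=` U -> smooth_ef U A -> smooth_ef U' A.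
Proof.
by move=> UU' sA i k; exact: Ck_on_subset (chart_image_subset UU') (sA i k).
Qed.

Lemma smooth_map_cst (W : normedModType R) U (w : W) :
  smooth_map U (fun _ : M => w).
Proof. by move=> i k; exact: Ck_on_cst. Qed.

Lemma vec_coordD i Y Y' y :
  vec_coord i (fun y => Y y + Y' y) y = vec_coord i Y y + vec_coord i Y' y.
Proof. exact: mulmxDr. Qed.

Lemma vec_coordZ i (f : M -> R) Y y :
  vec_coord i (fun y => f y *: Y y) y = f y *: vec_coord i Y y.
Proof. by rewrite /vec_coord -scalemxAr. Qed.

Lemma endo_coordD i A A' y :
  endo_coord i (fun y => A y + A' y) y = endo_coord i A y + endo_coord i A' y.
Proof. by rewrite /endo_coord mulmxDr mulmxDl. Qed.

Lemma endo_coordZ i (f : M -> R) A y :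
  endo_coord i (fun y => f y *: A y) y = f y *: endo_coord i A y.
Proof. by rewrite /endo_coord -scalemxAr -scalemxAl. Qed.

Lemma vec_coord_mulmx i A Y y : cdom i y ->
  vec_coord i (fun y => A y *m Y y) y = endo_coord i A y *m vec_coord i Y y.
Proof.
by move=> iy; rewrite /vec_coord /endo_coord !mulmxA mulmxKV // tchange_unit.
Qed.

Lemma vec_coord_chart_at x Y : vec_coord (chart_at x) Y x = Y x.
Proof. by rewrite /vec_coord tchange_chart_at mul1mx. Qed.

Lemma endo_coord_chart_at x A : endo_coord (chart_at x) A x = A x.
Proof.
by rewrite /endo_coord tchange_chart_at mul1mx invmx1 mulmx1.
Qed.

Section Open.
Variables (U : set M).
Hypothesis oU : open U.

Lemma smooth_vfD Y Y' : smooth_vf U Y -> smooth_vf U Y' ->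
  smooth_vf U (fun y => Y y + Y' y).
Proof.
move=> sY sY' i; have := smooth_onD (open_chart_image i oU) (sY i) (sY' i).
apply: smooth_on_ext; first exact: open_chart_image.
by move=> p _; rewrite /= vec_coordD.
Qed.

Lemma smooth_vfZ (f : M -> R) Y : smooth_map U f -> smooth_vf U Y ->
  smooth_vf U (fun y => f y *: Y y).
Proof.
move=> sf sY i; have := smooth_on_scalemx (open_chart_image i oU) (sf i) (sY i).
apply: smooth_on_ext; first exact: open_chart_image.
by move=> p _; rewrite /= vec_coordZ.
Qed.

Lemma smooth_vf0 : smooth_vf U (fun=> 0).
Proof.
move=> i k; have := @Ck_on_cst _ _ _ k (chart i @` (U `&` cdom i)) (0 : 'cV[R]_m).
apply: Ck_on_ext; first exact: open_chart_image.
by move=> p _; rewrite /= /vec_coord mulmx0.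
Qed.

Lemma smooth_vf_sum (I : Type) (r : seq I) (Y : I -> M -> 'cV[R]_m) :
  (forall l, smooth_vf U (Y l)) -> smooth_vf U (fun y => \sum_(l <- r) Y l y).
Proof.
move=> sY; elim: r => [|l r IH].
  by under eq_fun do rewrite big_nil; exact: smooth_vf0.
by under eq_fun do rewrite big_cons; exact: smooth_vfD.
Qed.

Lemma smooth_efD A A' : smooth_ef U A -> smooth_ef U A' ->
  smooth_ef U (fun y => A y + A' y).
Proof.
move=> sA sA' i; have := smooth_onD (open_chart_image i oU) (sA i) (sA' i).
apply: smooth_on_ext; first exact: open_chart_image.
by move=> p _; rewrite /= endo_coordD.
Qed.

Lemma smooth_efZ (f : M -> R) A : smooth_map U f -> smooth_ef U A ->
  smooth_ef U (fun y => f y *: A y).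
Proof.
move=> sf sA i; have := smooth_on_scalemx (open_chart_image i oU) (sf i) (sA i).
apply: smooth_on_ext; first exact: open_chart_image.
by move=> p _; rewrite /= endo_coordZ.
Qed.

Lemma smooth_vf_mulmx A Y : smooth_ef U A -> smooth_vf U Y ->
  smooth_vf U (fun y => A y *m Y y).
Proof.
move=> sA sY i; have := smooth_on_mulmx (open_chart_image i oU) (sA i) (sY i).
apply: smooth_on_ext; first exact: open_chart_image.
by move=> p [y [Uy iy] <-] /=; rewrite (chartK iy) vec_coord_mulmx.
Qed.

(** Smoothness in one chart is enough on its domain: in another chart the
    components are multiplied by the jacobian of the transition map. *)
Lemma smooth_vf_chart a Y : U `<=` cdom a ->
  smooth_on (chart a @` (U `&` cdom a)) (vec_coord a Y \o cinv a) ->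
  smooth_vf U Y.
Proof.
move=> Ua sY j.
have oj := open_chart_image j oU.
have oa := open_chart_image a (openI oU (@open_cdom _ _ M j)).
have ja p : (chart j @` (U `&` cdom j)) p ->
    (chart a @` ((U `&` cdom j) `&` cdom a)) (transition j a p).
  move=> [z [Uz jz] <-]; exists z; last by rewrite /= (chartK jz).
  by split => //; exact: Ua.
have st : smooth_on (chart j @` (U `&` cdom j)) (transition j a).
  move=> k; apply: Ck_on_subset (@transition_smooth _ _ M j a k).
  by move=> _ [z [Uz jz] <-]; exists z => //; split => //; exact: Ua.
have sJ : smooth_on (chart a @` ((U `&` cdom j) `&` cdom a))
    (jacobian_mx (transition a j)).
  apply: smooth_on_jacobian_mx => // k.
  apply: Ck_on_subset (@transition_smooth _ _ M a j k).
  by move=> _ [z [[Uz jz] az] <-]; exists z.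
have sY' : smooth_on (chart a @` ((U `&` cdom j) `&` cdom a))
    (vec_coord a Y \o cinv a).
  by move=> k; apply: Ck_on_subset (sY k); apply: chart_image_subset => z [].
have := smooth_on_mulmx oj (smooth_on_comp oj oa ja sJ st)
  (smooth_on_comp oj oa ja sY' st).
apply: smooth_on_ext; first exact: oj.
move=> p [y [Uy jy] <-] /=.
have ay := Ua _ Uy.
by rewrite (chartK jy) (chartK ay) /vec_coord (tchange_transition ay jy) mulmxA.
Qed.

End Open.
End Fields.

(** * Connections in coordinates *)

Section Derivatives.
Variables (R : realType) (V : normedModType R).

Lemma derive_mulmx m n p (F : V -> 'M[R]_(m, n)) (G : V -> 'M[R]_(n, p)) t v :
  derivable F t v -> derivable G t v ->
  'D_v (fun x => F x *m G x) t = 'D_v F t *m G t + F t *m 'D_v G t.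
Proof.
move=> dF dG.
have /derivable_mxP dF' := dF; have /derivable_mxP dG' := dG.
have E i j : (fun x => (F x *m G x) i j) =
    \sum_(k < n) ((fun x => F x i k) * (fun x => G x k j)).
  by apply/funext => x; rewrite fct_sumE mxE.
have dM i j k : derivable ((fun x => F x i k) * (fun x => G x k j)) t v.
  by apply: derivableM; [exact: dF'|exact: dG'].
have dFG : derivable (fun x => F x *m G x) t v.
  by apply/derivable_mxP => i j; rewrite E; apply: derivable_sum.
rewrite (derive_mx dFG); apply/matrixP => i j; rewrite mxE E derive_sum //.
rewrite !mxE -big_split /=; apply: eq_bigr => k _.
rewrite (deriveM (dF' i k) (dG' k j)).
rewrite addrC (derive_mx dF) (derive_mx dG) !mxE; congr (_ + _).
exact: mulrC.
Qed.

Lemma derive_coord m n (F : V -> 'M[R]_(m, n)) t v i j : derivable F t v ->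
  'D_v (fun x => F x i j) t = 'D_v F t i j.
Proof. by move=> dF; rewrite derive_mx // mxE. Qed.

End Derivatives.

Section Connections.
Variables (R : realType) (m : nat) (M : manifold R m).
Implicit Types (i j : cindex M) (x y : M) (U : set M).
Implicit Types (Y : M -> 'cV[R]_m) (A : M -> 'M[R]_m) (D : connection M).

Local Notation transition i j := (chart j \o cinv i).

(** The coordinate vector field of the chart [i] with index [k]. *)
Definition frame i (k : 'I_m) (y : M) : 'cV[R]_m :=
  invmx (tchange i y) *m delta_mx k 0.

Lemma vec_coord_frame i k y : cdom i y -> vec_coord i (frame i k) y = delta_mx k 0.
Proof.
by move=> iy; rewrite /vec_coord /frame mulmxA mulmxV ?tchange_unit // mul1mx.
Qed.

Lemma frame_chart_at x k : frame (chart_at x) k x = delta_mx k 0.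
Proof. by rewrite -(vec_coord_frame k (chart_atP x)) vec_coord_chart_at. Qed.

Lemma smooth_vf_frame i k : smooth_vf (cdom i) (frame i k).
Proof.
apply: (@smooth_vf_chart _ _ _ _ (@open_cdom _ _ M i) i) => // l.
have := @Ck_on_cst _ _ _ l (chart i @` (cdom i `&` cdom i)) (delta_mx k 0 : 'cV[R]_m).
apply: Ck_on_ext; first exact: open_chart_image (@open_cdom _ _ M i).
by move=> p [y [iy _] <-]; rewrite /= (chartK iy) vec_coord_frame.
Qed.

(** In another chart [j] these components are those of a product of the
    jacobian of the transition map with the coordinates of [Y]. *)
Lemma smooth_map_vec_coord i U Y k : open U -> smooth_vf U Y ->
  smooth_map (U `&` cdom i) (fun y => vec_coord i Y y k 0).
Proof.
move=> oU sY j; have oUi := openI oU (@open_cdom _ _ M i).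
have oj := open_chart_image j oUi.
have sJ : smooth_on (chart j @` ((U `&` cdom i) `&` cdom j))
    (jacobian_mx (transition j i)).
  apply: smooth_on_jacobian_mx => // l.
  apply: Ck_on_subset (@transition_smooth _ _ M j i l).
  by move=> _ [z [[Uz iz] jz] <-]; exists z.
have sYj : smooth_on (chart j @` ((U `&` cdom i) `&` cdom j))
    (vec_coord j Y \o cinv j).
  by move=> l; apply: Ck_on_subset (sY j l); apply: chart_image_subset => z [].
have := smooth_on_coord oj k 0 (smooth_on_mulmx oj sJ sYj).
apply: smooth_on_ext => // p [y [[Uy iy] jy] <-].
by rewrite /= (chartK jy) /vec_coord (tchange_transition jy iy) mulmxA.
Qed.

Lemma derivable_chart U x Y v : U x -> smooth_vf U Y ->
  derivable (vec_coord (chart_at x) Y \o cinv (chart_at x))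
    (chart (chart_at x) x) v.
Proof.
move=> Ux sY; apply: diff_derivable.
apply: smooth_on_differentiable (sY (chart_at x)) _.
by exists x => //; split => //; exact: chart_atP.
Qed.

Lemma derivable_chart_endo U x A v : U x -> smooth_ef U A ->
  derivable (endo_coord (chart_at x) A \o cinv (chart_at x))
    (chart (chart_at x) x) v.
Proof.
move=> Ux sA; apply: diff_derivable.
apply: smooth_on_differentiable (sA (chart_at x)) _.
by exists x => //; split => //; exact: chart_atP.
Qed.

Lemma frame_decomposition i Y y : cdom i y ->
  Y y = \sum_k vec_coord i Y y k 0 *: frame i k y.
Proof.
move=> iy; apply: (can_inj (mulKmx (tchange_unit iy))).
rewrite mulmx_sumr -[LHS]/(vec_coord i Y y).
rewrite [LHS]matrix_sum_delta; apply: eq_bigr => k _; rewrite big_ord1.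
have e : tchange i y *m frame i k y = delta_mx k 0 := vec_coord_frame k iy.
by rewrite -scalemxAr e.
Qed.

Lemma cov0 D x v : cov D (fun=> 0) x v = 0.
Proof.
have := cov_add D v openT (I : setT x) (smooth_vf0 openT) (smooth_vf0 openT).
have -> : (fun y : M => (0 : 'cV[R]_m) + 0) = fun=> 0.
  by apply/funext => y; rewrite addr0.
by move/eqP; rewrite -subr_eq0 opprD addNKr oppr_eq0 => /eqP.
Qed.

Lemma cov_sum D U x v (I : Type) (r : seq I) (Y : I -> M -> 'cV[R]_m) :
  open U -> U x -> (forall l, smooth_vf U (Y l)) ->
  cov D (fun y => \sum_(l <- r) Y l y) x v = \sum_(l <- r) cov D (Y l) x v.
Proof.
move=> oU Ux sY; elim: r => [|l r IH].
  by under eq_fun do rewrite big_nil; rewrite big_nil cov0.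
under eq_fun do rewrite big_cons.
rewrite big_cons -IH.
exact: (cov_add D v oU Ux (sY l) (smooth_vf_sum oU r sY)).
Qed.

(** The matrix of the connection form in the coordinate frame of the chart at
    [x]: its [l]-th column is the derivative along [v] of the [l]-th frame
    field. *)
Definition christoffel D x (v : 'cV[R]_m) : 'M[R]_m :=
  \matrix_(k, l) cov D (frame (chart_at x) l) x v k 0.

Lemma christoffel_delta D x v l :
  christoffel D x v *m delta_mx l 0 = cov D (frame (chart_at x) l) x v.
Proof. by apply/colP => k; rewrite -colE !mxE. Qed.

(** Near [x] the field [Y] is the combination of the coordinate frame with its
    components as coefficients, by locality of the connection; the Leibniz rule
    then separates the derivatives of the components from those of the
    frame. *)
Lemma cov_coordE D U Y x v : open U -> U x -> smooth_vf U Y ->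
  cov D Y x v =
    dirder (vec_coord (chart_at x) Y) x v + christoffel D x v *m Y x.
Proof.
move=> oU Ux sY; set a := chart_at x.
have ax : cdom a x := chart_atP x.
have oUa := openI oU (@open_cdom _ _ M a).
have sE k : smooth_vf (U `&` cdom a) (frame a k).
  by apply: smooth_vf_subset (smooth_vf_frame a k) => z [].
have sf k := smooth_map_vec_coord a k oU sY.
have sfE k := smooth_vfZ oUa (sf k) (sE k).
have sY' : smooth_vf (U `&` cdom a) Y by apply: smooth_vf_subset sY => z [].
have Uax : (U `&` cdom a) x by [].
have dec y : (U `&` cdom a) y ->
    Y y = \sum_k vec_coord a Y y k 0 *: frame a k y.
  by move=> [_ ay]; exact: frame_decomposition.
rewrite (cov_local D v oUa Uax sY' (smooth_vf_sum oUa _ sfE) dec).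
rewrite (cov_sum D v _ oUa Uax sfE).
under eq_bigr => k _ do rewrite (cov_leibniz D v oUa Uax (sf k) (sE k)).
rewrite big_split /=; congr (_ + _).
  rewrite [RHS]matrix_sum_delta; apply: eq_bigr => k _; rewrite big_ord1.
  rewrite frame_chart_at; congr (_ *: _).
  exact: (derive_coord k 0 (derivable_chart Ux sY)).
rewrite [in RHS](frame_decomposition Y ax) mulmx_sumr.
apply: eq_bigr => k _.
by rewrite -scalemxAr frame_chart_at christoffel_delta.
Qed.

(** The expression in the chart at [x] of the derivative of [A] for the
    connection induced by [D] on End(TM). *)
Definition endo_derivative D A x v : 'M[R]_m :=
  dirder (endo_coord (chart_at x) A) x v
    + (christoffel D x v *m A x - A x *m christoffel D x v).

(** The defining property of the covariant derivative is tested on arbitrary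
    fields, but its right-hand side only depends on their value at [x]: by the
    product rule the derivatives of [Y] cancel. Conversely the coordinate frame
    spans the tangent space at [x], so there is a unique such matrix. *)
Lemma cov_endoP D U A x v B : open U -> U x -> smooth_ef U A ->
  cov_endo D A x v B <-> B = endo_derivative D A x v.
Proof.
move=> oU Ux sA.
have key U' Y : open U' -> U' x -> smooth_vf U' Y ->
    cov D (fun y => A y *m Y y) x v - A x *m cov D Y x v =
    endo_derivative D A x v *m Y x.
  move=> oU' U'x sY'.
  have oW := openI oU oU'; have Wx : (U `&` U') x by [].
  have sY : smooth_vf (U `&` U') Y by apply: smooth_vf_subset sY' => z [].
  have sAW : smooth_ef (U `&` U') A by apply: smooth_ef_subset sA => z [].
  have sAY := smooth_vf_mulmx oW sAW sY.
  rewrite (cov_coordE D v oW Wx sY) (cov_coordE D v oW Wx sAY).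
  have -> : dirder (vec_coord (chart_at x) (fun y => A y *m Y y)) x v =
      dirder (endo_coord (chart_at x) A) x v *m Y x
      + A x *m dirder (vec_coord (chart_at x) Y) x v.
    rewrite /dirder.
    rewrite (@near_eq_derive _ _ _ _ (fun p =>
      (endo_coord (chart_at x) A \o cinv (chart_at x)) p *m
      (vec_coord (chart_at x) Y \o cinv (chart_at x)) p)); last first.
      apply: filterS (near_cinv openT I (chart_atP x)) => p [y [_ ay] <-].
      by rewrite /= (chartK ay) vec_coord_mulmx.
    rewrite derive_mulmx; last 2 first.
    - exact: derivable_chart_endo Ux sA.
    - exact: derivable_chart Wx sY.
    by rewrite /= (chartK (chart_atP x)) vec_coord_chart_at endo_coord_chart_at.
  rewrite /endo_derivative mulmxDr !mulmxDl mulNmx !mulmxA.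
  by rewrite [X in X - _ = _]addrAC opprD !addrA addrK.
split=> [covB|->]; last by move=> U' Y oU' U'x sY; rewrite (key U').
have sE := smooth_vf_frame (chart_at x).
have ax := chart_atP x; have oa := @open_cdom _ _ M (chart_at x).
apply/matrixP => k l.
have := covB _ _ oa ax (sE l); rewrite (key _ _ oa ax (sE l)).
by rewrite frame_chart_at -!colE => /colP /(_ k); rewrite !mxE.
Qed.

Lemma endo_derivativeB D D' A x v :
  endo_derivative D' A x v = endo_derivative D A x v
    + ((christoffel D' x v - christoffel D x v) *m A x
       - A x *m (christoffel D' x v - christoffel D x v)).
Proof.
rewrite /endo_derivative -addrA; congr (_ + _).
by rewrite mulmxBl mulmxBr addrACA subrKC -opprD subrKC.
Qed.

End Connections.

(** * Quaternion algebra *)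

Section QuaternionAlgebra.
Variables (R : realType) (m : nat).
Implicit Types (I J K S : 'M[R]_m).

Definition quaternion_triple I J K : Prop :=
  [/\ I *m I = - 1%:M, J *m J = - 1%:M, K *m K = - 1%:M, I *m J = K &
      J *m I = - K].

Lemma quaternion_tripleE I J K : quaternion_triple I J K ->
  [/\ J *m K = I, K *m J = - I, K *m I = J & I *m K = - J].
Proof.
case=> II JJ KK IJ JI.
split.
- by rewrite -[K]opprK -JI mulmxN mulmxA JJ mulNmx mul1mx opprK.
- by rewrite -IJ -mulmxA JJ mulmxN mulmx1.
- by rewrite -[K]opprK -JI mulNmx -mulmxA II mulmxN mulmx1 opprK.
- by rewrite -IJ mulmxA II mulNmx mul1mx.
Qed.

Lemma quaternion_triple_cycle I J K :
  quaternion_triple I J K -> quaternion_triple J K I.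
Proof. by move=> q; case: (quaternion_tripleE q); case: q. Qed.

Definition quaternion_span I J K : set 'M[R]_m :=
  [set B | exists a b c : R, B = a *: I + b *: J + c *: K].

Definition commutator S J := S *m J - J *m S.

Lemma commutatorB S S' J :
  commutator (S - S') J = commutator S J - commutator S' J.
Proof.
rewrite /commutator mulmxBl mulmxBr !opprD !opprK addrACA.
by congr (_ + _); rewrite addrC.
Qed.

(** The square of [a I + b J + c K] is [- (a^2 + b^2 + c^2)]. *)
Lemma quaternion_free I J K (a b c : R) : (0 < m)%N ->
  quaternion_triple I J K -> a *: I + b *: J + c *: K = 0 ->
  [/\ a = 0, b = 0 & c = 0].
Proof.
move=> m0 q E; have [JK KJ KI IK] := quaternion_tripleE q.
case: q => II JJ KK IJ JI.
have : (a *: I + b *: J + c *: K) *m (a *: I + b *: J + c *: K) = 0.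
  by rewrite E mul0mx.
rewrite !(mulmxDl, mulmxDr) -!scalemxAl -!scalemxAr.
rewrite II JJ KK IJ JI JK KJ KI IK => /matrixP /(_ (Ordinal m0) (Ordinal m0)).
rewrite !mxE eqxx => e.
have {}e : a ^+ 2 + b ^+ 2 + c ^+ 2 = 0 by move: e; rewrite mulr1n; lra.
have := sqr_ge0 a; have := sqr_ge0 b; have := sqr_ge0 c => c2 b2 a2.
by split; apply/eqP; rewrite -sqrf_eq0; apply/eqP; lra.
Qed.

Lemma quaternion_commutator I J K S0 (a b c : R) : quaternion_triple I J K ->
  S0 *m I = I *m S0 ->
  commutator (S0 + a *: I + b *: J + c *: K) I = (2 * c) *: J - (2 * b) *: K.
Proof.
move=> q S0I; have [JK KJ KI IK] := quaternion_tripleE q.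
case: q => II JJ KK IJ JI.
rewrite /commutator !(mulmxDl, mulmxDr) -!scalemxAl -!scalemxAr.
rewrite S0I II IJ JI KI IK; move: (I *m S0) => X.
by apply/matrixP => i j; rewrite !mxE; ring.
Qed.

(** Both commutators are combinations of [J] and [K] only, and multiplication
    by [I] permutes [J] and [K] up to sign: comparing the coefficients of [J]
    and [K] gives two equations. *)
Lemma quaternion_relation I J K S0 T0 (s1 s2 s3 t1 t2 t3 : R) : (0 < m)%N ->
  quaternion_triple I J K -> S0 *m I = I *m S0 -> T0 *m I = I *m T0 ->
  commutator (T0 + t1 *: I + t2 *: J + t3 *: K) I
    + I *m commutator (S0 + s1 *: I + s2 *: J + s3 *: K) I = 0 ->
  t2 = s3 /\ t3 = - s2.
Proof.
move=> m0 q S0I T0I; rewrite !(quaternion_commutator _ _ _ q) // => e.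
have [JK KJ KI IK] := quaternion_tripleE q.
have [II JJ KK IJ JI] := q.
have [_ e2 e3] : [/\ 0 = 0 :> R, 2 * t3 + 2 * s2 = 0 & 2 * s3 - 2 * t2 = 0].
  apply: (quaternion_free m0 q); rewrite -[RHS]e.
  rewrite mulmxBr -!scalemxAr IK IJ.
  by apply/matrixP => i j; rewrite !mxE; ring.
by split; lra.
Qed.

(** Averaging [S] over the conjugations by the quaternion group gives
    [(S - I S I - J S J - K S K) / 4], which commutes with [I], [J] and [K].
    The rest of [S] is a quarter of the sum of the products of [I], [J], [K]
    with the commutators of [S] with them, hence a quaternion, whose real part
    can be moved to the commuting part. *)
Lemma quaternion_splitting I J K S : quaternion_triple I J K ->
  quaternion_span I J K (commutator S I) ->
  quaternion_span I J K (commutator S J) ->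
  quaternion_span I J K (commutator S K) ->
  exists S0 (s1 s2 s3 : R),
    [/\ S0 *m I = I *m S0, S0 *m J = J *m S0, S0 *m K = K *m S0 &
        S = S0 + s1 *: I + s2 *: J + s3 *: K].
Proof.
move=> q [a1 [b1 [c1 e1]]] [a2 [b2 [c2 e2]]] [a3 [b3 [c3 e3]]].
have [JK KJ KI IK] := quaternion_tripleE q.
case: q => II JJ KK IJ JI.
(* [N] is four times the average. *)
pose N := S - I *m S *m I - J *m S *m J - K *m S *m K.
have NI : N *m I = I *m N.
  have tI X : ((X *m I *m I = - X) * (X *m J *m I = - (X *m K)) *
      (X *m K *m I = X *m J))%type.
    by rewrite -!mulmxA II JI KI !mulmxN mulmx1.
  rewrite /N !(mulmxBl, mulmxBr, mulmxA) !tI II IJ IK !mulNmx mul1mx.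
  move: (J *m S *m K) (K *m S *m J) => X Y.
  by apply/matrixP => i j; rewrite !mxE; ring.
have NJ : N *m J = J *m N.
  have tJ X : ((X *m J *m J = - X) * (X *m I *m J = X *m K) *
      (X *m K *m J = - (X *m I)))%type.
    by rewrite -!mulmxA JJ IJ KJ !mulmxN mulmx1.
  rewrite /N !(mulmxBl, mulmxBr, mulmxA) !tJ JJ JI JK !mulNmx mul1mx.
  move: (I *m S *m K) (K *m S *m I) => X Y.
  by apply/matrixP => i j; rewrite !mxE; ring.
have NK : N *m K = K *m N by rewrite -IJ mulmxA NI -mulmxA NJ mulmxA.
have NE : 4 *: S = N - (a1 + b2 + c3) *: 1%:M + (c2 - b3) *: I
    + (a3 - c1) *: J + (b1 - a2) *: K.
  have f1 := congr1 (mulmx I) e1; have f2 := congr1 (mulmx J) e2.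
  have f3 := congr1 (mulmx K) e3.
  rewrite /commutator !(mulmxDr, mulmxN, mulmxA) -!scalemxAr in f1 f2 f3.
  rewrite II IJ IK mulNmx mul1mx in f1; rewrite JJ JI JK mulNmx mul1mx in f2.
  rewrite KK KI KJ mulNmx mul1mx in f3.
  move: f1 f2 f3; rewrite /N.
  move: (I *m S *m I) (J *m S *m J) (K *m S *m K) => X Y Z.
  move=> /matrixP f1 /matrixP f2 /matrixP f3.
  apply/matrixP => i j; move: (f1 i j) (f2 i j) (f3 i j); rewrite !mxE => g1 g2 g3.
  by lra.
clearbody N; pose N0 := N - (a1 + b2 + c3) *: 1%:M.
have commN0 L : N *m L = L *m N -> (4^-1 *: N0) *m L = L *m (4^-1 *: N0).
  move=> NL; rewrite -scalemxAl -scalemxAr /N0 mulmxBl mulmxBr NL.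
  by rewrite -scalemxAl -scalemxAr mul1mx mulmx1.
exists (4^-1 *: N0), ((c2 - b3) / 4), ((a3 - c1) / 4), ((b1 - a2) / 4).
split; [exact: commN0|exact: commN0|exact: commN0|].
have -> : S = 4^-1 *: (4 *: S) by rewrite scalerA mulVf ?scale1r // pnatr_eq0.
rewrite NE /N0.
by apply/matrixP => i j; rewrite !mxE; lra.
Qed.

End QuaternionAlgebra.

(** * Derivatives along lines and of scalar multiples *)

Section Lines.
Variables (R : realType).

Lemma Ck_on_id (V : normedModType R) k (U : set V) : Ck_on k U (id : V -> V).
Proof.
case: k => [|k]; first by move=> x _.
split=> [x _|v]; first by have [] := is_diff_id x.
have -> : (fun x => 'd (id : V -> V) x v) = cst v.
  by apply/funext => x; have [_ ->] := is_diff_id x.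
exact: Ck_on_cst.
Qed.

Lemma derive_line (V W : normedModType R) (F : V -> W) (p v : V) :
  'D_1 (fun t : R => F (t *: v + p)) 0 = 'D_v F p.
Proof.
rewrite /derive; set f := (X in lim (X @ _)); set g := (X in _ = lim (X @ _)).
suff -> : f = g by [].
apply/funext => h; rewrite /f /g /=.
by rewrite scale0r add0r addr0 [h *: 1]mulr1.
Qed.

Lemma smooth_line (V : normedModType R) (p v : V) (U : set R) : open U ->
  smooth_on U (fun t : R => t *: v + p).
Proof.
move=> oU k; apply: (Ck_onD oU); last exact: Ck_on_cst.
exact: (Ck_onZl v oU (@Ck_on_id _ k U)).
Qed.

Lemma near_line (V : normedModType R) (p v : V) (U : set V) : open U -> U p ->
  exists2 e : R, 0 < e & forall t, ball (0 : R) e t -> U (t *: v + p).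
Proof.
move=> oU Up.
have c : {for (0 : R), continuous (fun t : R => t *: v + p)}.
  by have := smooth_line p v openT; move=> /(_ 0%N 0 I).
rewrite /prop_for /continuous_at scale0r add0r in c.
have := c _ (open_nbhs_nbhs (conj oU Up)).
by move=> /nbhs_ballP [e e0 eU]; exists e => // t; exact: eU.
Qed.

Lemma derivable_scalemx (V : normedModType R) m n (f : V -> R)
    (F : V -> 'M[R]_(m, n)) t v :
  derivable f t v -> derivable F t v -> derivable (fun x => f x *: F x) t v.
Proof.
move=> df /derivable_mxP dF; apply/derivable_mxP => i j.
have -> : (fun x => (f x *: F x) i j) = f * (fun x => F x i j).
  by apply/funext => x; rewrite mxE.
exact: derivableM df (dF i j).
Qed.

Lemma derive_scalemx (V : normedModType R) m n (f : V -> R)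
    (F : V -> 'M[R]_(m, n)) t v :
  derivable f t v -> derivable F t v ->
  'D_v (fun x => f x *: F x) t = 'D_v f t *: F t + f t *: 'D_v F t.
Proof.
move=> df dF; have /derivable_mxP dF' := dF.
have E i j : (fun x => (f x *: F x) i j) = f * (fun x => F x i j).
  by apply/funext => x; rewrite mxE.
rewrite (derive_mx (derivable_scalemx df dF)); apply/matrixP => i j; rewrite mxE E.
rewrite (deriveM df (dF' i j)) addrC (derive_mx dF) !mxE; congr (_ + _).
exact: mulrC.
Qed.

End Lines.

(** * Sections of a quaternionic structure *)

Section Sections.
Variables (R : realType) (m : nat) (M : manifold R m) (Q : endo_family M).
Implicit Types (x y : M) (U : set M) (A sigma : M -> 'M[R]_m) (D : connection M).

Lemma admissible_triple U J1 J2 J3 x : admissible_basis Q U J1 J2 J3 -> U x ->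
  quaternion_triple (J1 x) (J2 x) (J3 x).
Proof.
case=> _ _ sq prod _ Ux; have [? ? ?] := sq x Ux; have [? e] := prod x Ux.
by split => //; rewrite -e opprK.
Qed.

Lemma admissible_span U J1 J2 J3 x : admissible_basis Q U J1 J2 J3 -> U x ->
  Q x = quaternion_span (J1 x) (J2 x) (J3 x).
Proof. by case=> _ _ _ _ QE Ux; rewrite (QE x Ux). Qed.

Lemma admissible_section U J1 J2 J3 (a b c : R) :
  admissible_basis Q U J1 J2 J3 ->
  section_of Q U (fun y => a *: J1 y + b *: J2 y + c *: J3 y).
Proof.
move=> adm; have [oU [s1 s2 s3] _ _ _] := adm; split.
  have cst (d : R) := smooth_map_cst (M := M) U d.
  by apply: smooth_efD => //; [apply: smooth_efD => //|]; apply: smooth_efZ.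
by move=> y Uy; rewrite (admissible_span adm Uy); exists a, b, c.
Qed.

Lemma admissible_section1 U J1 J2 J3 :
  admissible_basis Q U J1 J2 J3 -> section_of Q U J1.
Proof.
move=> adm; have [_ [sJ1 _ _] _ _ _] := adm; split=> // y Uy.
rewrite (admissible_span adm Uy); exists 1, 0, 0.
by rewrite scale1r !scale0r !addr0.
Qed.

Lemma admissible_cycle U J1 J2 J3 :
  admissible_basis Q U J1 J2 J3 -> admissible_basis Q U J2 J3 J1.
Proof.
move=> adm; have trip y := @admissible_triple _ _ _ _ y adm.
case: adm => oU [s1 s2 s3] _ _ QE; split=> // y Uy.
- by have [] := quaternion_triple_cycle (trip y Uy).
- by have [_ _ _ -> ->] := quaternion_triple_cycle (trip y Uy); rewrite opprK.
- rewrite QE //; apply/seteqP; split=> _ [a [b [c ->]]].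
    by exists b, c, a; rewrite [RHS]addrC addrA.
  by exists c, a, b; rewrite [LHS]addrC addrA.
Qed.

Lemma endo_derivative0 D A x : endo_derivative D A x 0 = 0.
Proof.
have c0 : christoffel D x 0 = 0.
  apply/matrixP => k l; rewrite !mxE.
  have := cov_linear D 1 0 0 (@open_cdom _ _ M _) (chart_atP x)
    (smooth_vf_frame (chart_at x) l).
  rewrite scaler0 addr0 scale1r => /eqP.
  by rewrite -subr_eq0 opprD addNKr oppr_eq0 => /eqP ->; rewrite mxE.
by rewrite /endo_derivative c0 mulmx0 mul0mx subrr addr0 /dirder derive0.
Qed.

(** An affine function of one coordinate along which [v] does not vanish. *)
Lemma exists_slope x (v : 'cV[R]_m) : v != 0 ->
  exists g : M -> R, [/\ smooth_map (cdom (chart_at x)) g, g x = 0 &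
    derivable (g \o cinv (chart_at x)) (chart (chart_at x) x) v /\
    dirder g x v = 1].
Proof.
move=> v0; set a := chart_at x; have oa := @open_cdom _ _ M a.
have [l vl] : exists l, v l 0 != 0.
  apply/existsP; apply: contraNT v0; rewrite negb_exists => /forallP vl.
  apply/eqP/colP => l; rewrite mxE; apply/eqP.
  by have := vl l; rewrite negbK.
pose h (p : 'cV[R]_m) : R := (v l 0)^-1 * (p l 0 + - chart a x l 0).
have sh (U : set 'cV[R]_m) : open U -> smooth_on U h.
  move=> oU k; apply: (Ck_onM oU); first exact: Ck_on_cst.
  apply: (Ck_onD oU); last exact: Ck_on_cst.
  exact: (Ck_on_coord l 0 oU (@Ck_on_id R _ k U)).
exists (h \o chart a); split.
- move=> j; have oj := open_chart_image j oa.
  move=> k; apply: (Ck_on_comp oj (U' := setT)) => //; first exact: sh openT k.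
  apply: Ck_on_subset (@transition_smooth _ _ M j a k).
  by move=> _ [z [az jz] <-]; exists z.
- by rewrite /= /h subrr mulr0.
have hE : \forall p \near chart a x, h p = ((h \o chart a) \o cinv a) p.
  by apply: filterS (near_chartK (chart_atP x)) => p /= ->.
have dh : derivable h (chart a x) v.
  exact/diff_derivable/(smooth_on_differentiable (sh _ openT)).
split; first exact: near_eq_derivable dh.
rewrite /dirder -(near_eq_derive _ hE).
have dc : derivable (fun p : 'cV[R]_m => p l 0) (chart a x) v.
  exact/diff_derivable/differentiable_coord.
rewrite (_ : h = (v l 0)^-1 *: ((fun p : 'cV[R]_m => p l 0) - cst (chart a x l 0))) //.
have dcst := @derivable_cst _ _ _ (chart a x l 0) (chart a x) v.
rewrite (deriveZ _ (derivableB dc dcst)) (deriveB dc dcst) derive_cst subr0.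
rewrite (derive_coord l 0 (@derivable_id _ _ (chart a x) v)) derive_id.
exact: mulVf.
Qed.

(** A local section of [Q] can be corrected, to first order and without moving
    its value at [x], so that it becomes parallel along [v]: its derivative
    there lies in [Q], hence is the value at [x] of another section [tau], and
    subtracting [g tau] with [g] vanishing at [x] and of slope [1] along [v]
    removes it. For [v = 0] there is no such [g], but every derivative along
    [v] vanishes. *)
Lemma exists_parallel D U J1 J2 J3 sigma x (v : 'cV[R]_m) : quaternionic Q D ->
  admissible_basis Q U J1 J2 J3 -> section_of Q U sigma -> U x ->
  exists (O : set M) tau, [/\ open O /\ O x, section_of Q O tau,
    tau x = sigma x & cov_endo D tau x v 0].
Proof.
move=> qD adm ssig Ux; have [oU _ _ _ _] := adm; have [ssm sQ] := ssig.
have [->|v0] := eqVneq v 0.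
  exists U, sigma; split=> //; apply/(cov_endoP D 0 0 oU Ux ssm).
  by rewrite endo_derivative0.
have [g [sg gx [dg g1]]] := exists_slope x v0.
have [B covB] := qD U sigma oU ssig x v Ux.
have BE := (cov_endoP D v B oU Ux ssm).1 covB.
rewrite (admissible_span adm Ux) => -[b1 [b2 [b3 Bb]]].
pose tau y := b1 *: J1 y + b2 *: J2 y + b3 *: J3 y.
have [stm tQ] : section_of Q U tau := admissible_section b1 b2 b3 adm.
pose a := chart_at x.
have oO := openI oU (@open_cdom _ _ M a).
have Ox : (U `&` cdom a) x by split => //; exact: chart_atP.
have sN : smooth_map (U `&` cdom a) (fun y => - g y).
  move=> j k; have oj := open_chart_image j oO.
  apply: (Ck_on_ext (f := fun p => -1 * (g \o cinv j) p) oj).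
    by move=> p _; rewrite mulN1r.
  apply: (Ck_onM oj); first exact: Ck_on_cst.
  by apply: Ck_on_subset (sg j k); apply: chart_image_subset => z [].
have sub : U `&` cdom a `<=` U by move=> z [].
have ss : smooth_ef (U `&` cdom a) (fun y => sigma y + (- g y) *: tau y).
  by apply: smooth_efD => //; [|apply: smooth_efZ => //]; exact: smooth_ef_subset sub _.
have sx : sigma x + (- g x) *: tau x = sigma x by rewrite gx oppr0 scale0r addr0.
exists (U `&` cdom a), (fun y => sigma y + (- g y) *: tau y); split => //.
  split=> // y [Uy _]; have := sQ y Uy; have := tQ y Uy.
  rewrite (admissible_span adm Uy) => -[t1 [t2 [t3 ->]]] [u1 [u2 [u3 ->]]].
  exists (u1 - g y * t1), (u2 - g y * t2), (u3 - g y * t3).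
  by apply/matrixP => i j; rewrite !mxE; ring.
apply/(cov_endoP D v 0 oO Ox ss).
rewrite /endo_derivative sx.
suff -> : dirder (endo_coord a (fun y => sigma y + (- g y) *: tau y)) x v =
    dirder (endo_coord a sigma) x v - tau x.
  by rewrite addrAC -[X in X - _]/(endo_derivative D sigma x v) -BE Bb subrr.
have dN : derivable (fun p => - (g \o cinv a) p) (chart a x) v := derivableN dg.
have dtau := derivable_chart_endo (v := v) Ux stm.
have dsig := derivable_chart_endo (v := v) Ux ssm.
have dNtau : derivable (fun p => (- (g \o cinv a) p) *:
    (endo_coord a tau \o cinv a) p) (chart a x) v := derivable_scalemx dN dtau.
rewrite /dirder (_ : _ \o _ = (endo_coord a sigma \o cinv a) +
  (fun p => (- (g \o cinv a) p) *: (endo_coord a tau \o cinv a) p)); last first.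
  by apply/funext => p; rewrite /= endo_coordD endo_coordZ.
rewrite (deriveD dsig dNtau) (derive_scalemx dN dtau).
have -> : 'D_v (fun p => - (g \o cinv a) p) (chart a x) = - 1.
  by rewrite -g1; exact: deriveN dg.
rewrite /= (chartK (chart_atP x)) gx endo_coord_chart_at.
by rewrite oppr0 scale0r addr0 scaleN1r.
Qed.

End Sections.

(** * Horizontal lifts and the structure I_2 *)

Section Twistor.
Variables (R : realType) (m : nat) (M : manifold R m) (Q : endo_family M).
Implicit Types (x y : M) (U : set M) (A sigma : M -> 'M[R]_m) (D : connection M).

(** A vanishing covariant derivative prescribes the derivative of the
    coordinates of the section: horizontal vectors over a given vector are
    unique. *)
Lemma horizontalE D x J xi : horizontal Q D x J xi ->
  xi = (xi.1, - commutator (christoffel D x xi.1) J).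
Proof.
case=> U [sigma [[oU Ux] [ssm _] sx cov0 ->]] /=.
have /esym/eqP := (cov_endoP D _ 0 oU Ux ssm).1 cov0.
by rewrite /section_push /endo_derivative sx addr_eq0 => /eqP ->.
Qed.

Section Basis.
Variables (U : set M) (J1 J2 J3 sigma : M -> 'M[R]_m) (x : M).
Hypothesis adm : admissible_basis Q U J1 J2 J3.
Hypothesis ssig : section_of Q U sigma.
Hypothesis sq : forall y, U y -> sigma y *m sigma y = - 1%:M.
Hypothesis Ux : U x.

Lemma hliftE D v : quaternionic Q D ->
  hlift Q D x (sigma x) v = (v, - commutator (christoffel D x v) (sigma x)).
Proof.
move=> qD; apply: xget_unique => [|xi [/horizontalE -> /= ->] //].
have [N [tau [[oN Nx] stau tx covt]]] := exists_parallel v qD adm ssig Ux.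
have hor : horizontal Q D x (sigma x) (section_push tau x v).
  by exists N, tau; split.
by split; [rewrite -[X in (X, _)]/(section_push tau x v).1 -(horizontalE hor)|].
Qed.

(** Differentiate [sigma^2 = -1]; it follows that the derivative of [sigma] is
    a vertical vector of the twistor space. *)
Lemma endo_derivative_anticomm D v :
  endo_derivative D sigma x v *m sigma x
    + sigma x *m endo_derivative D sigma x v = 0.
Proof.
have [oU _ _ _ _] := adm; have [ssm _] := ssig.
pose a := chart_at x; pose S := endo_coord a sigma \o cinv a.
have dS : derivable S (chart a x) v := derivable_chart_endo Ux ssm.
have SS : \forall p \near chart a x, S p *m S p = - 1%:M.
  apply: filterS (near_cinv oU Ux (chart_atP x)) => p [y [Uy ay] <-].
  rewrite /S /= (chartK ay) /endo_coord !mulmxA mulmxKV ?tchange_unit //.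
  rewrite -[_ *m sigma y *m sigma y]mulmxA sq // mulmxN mulmx1 mulNmx.
  by rewrite mulmxV // tchange_unit.
have Sx : S (chart a x) = sigma x.
  by rewrite /S /= (chartK (chart_atP x)) endo_coord_chart_at.
have := near_eq_derive v SS.
rewrite derive_cst (derive_mulmx dS dS) Sx => dSS.
rewrite /endo_derivative -[dirder _ _ _]/('D_v S (chart a x)).
move: dSS; set d := 'D_v S _; set G := christoffel _ _ _ => dSS.
rewrite mulmxDl mulmxDr addrACA dSS add0r mulmxBl mulmxBr !mulmxA.
by rewrite subrKA -(mulmxA G) !sq // mulmxN mulmx1 mulNmx mul1mx subrr.
Qed.

(** The velocity of [sigma] along [v] is the horizontal lift of [v] plus the
    covariant derivative of [sigma], and this is its only decomposition into a
    vertical and a horizontal vector. *)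
Lemma I2_section_push D v : quaternionic Q D ->
  I2 Q D x (sigma x) (section_push sigma x v) =
  (sigma x *m v, - (sigma x *m endo_derivative D sigma x v)
     - commutator (christoffel D x (sigma x *m v)) (sigma x)).
Proof.
move=> qD; have [oU _ _ _ _] := adm; have [ssm _] := ssig.
set J := sigma x; set W := endo_derivative D sigma x v.
have pushE : section_push sigma x v = (0, W) + hlift Q D x J v.
  rewrite hliftE // /section_push /W /endo_derivative -/J.
  by congr pair; rewrite ?add0r // -addrA subrr addr0.
apply: xget_unique.
  exists W, v; split=> //; last by rewrite hliftE //; congr pair; rewrite add0r.
  split; last exact: endo_derivative_anticomm.
  have [B covB QB] := qD U sigma oU ssig x v Ux.
  by rewrite /W -((cov_endoP D v B oU Ux ssm).1 covB).
move=> eta [W' [v' [_ e ->]]].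
have ev : v' = v.
  have := congr1 fst e; rewrite pushE !hliftE // => /=.
  by rewrite !add0r => ->.
have eW : W' = W.
  have := congr1 snd e; rewrite pushE ev !hliftE // => /=.
  by move/addIr.
by rewrite ev eW hliftE //; congr pair; rewrite add0r.
Qed.

(** The restriction of [sigma] to a coordinate line through [x] is a curve in
    the twistor space. *)
Lemma twistor_tangent_push v :
  twistor_tangent Q x (sigma x) (section_push sigma x v).
Proof.
have [oU _ _ _ _] := adm; have [ssm sQ] := ssig.
pose a := chart_at x; pose p0 := chart a x.
have oV := open_chart_image a oU.
have Vp0 : (chart a @` (U `&` cdom a)) p0.
  by exists x => //; split => //; exact: chart_atP.
have [e e0 eV] := near_line v oV Vp0.
pose p (t : R) := t *: v + p0; pose g t := cinv a (p t).
pose F := endo_coord a sigma \o cinv a.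
have pg t : ball (0 : R) e t -> [/\ U (g t), cdom a (g t) & p t = chart a (g t)].
  by move=> /eV [y [Uy ay]]; rewrite /g /p => <-; rewrite (chartK ay).
exists e, g, (sigma \o g), p, (F \o p); split; first exact: e0.
- move=> t /pg [Ug ag pE]; split=> //.
  by split; [exact: sQ|exact: sq].
- have ob : open (ball (0 : R) e) by exact: ball_open.
  split; first exact: smooth_line.
  by apply: (smooth_on_comp ob oV eV (ssm a)); exact: smooth_line.
- have g0 : g 0 = x by rewrite /g /p scale0r add0r (chartK (chart_atP x)).
  by rewrite /comp g0.
- have p' : 'D_1 p 0 = v := etrans (derive_line id p0 v) (derive_id p0 v).
  have F' : 'D_1 (F \o p) 0 = 'D_v F p0 := derive_line F p0 v.
  by rewrite p' F'.
Qed.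

(** Compare the vertical components of the two values on the velocity of
    [sigma] along [v]: the derivatives of [sigma] for [D] and [D'] differ by
    the commutator of [S v] with [sigma x], the lifts of [sigma x *m v] by that
    of [S (sigma x *m v)]. *)
Lemma I2_relation D D' v : quaternionic Q D -> quaternionic Q D' ->
  (forall xi, twistor_tangent Q x (sigma x) xi ->
     I2 Q D x (sigma x) xi = I2 Q D' x (sigma x) xi) ->
  let S w := christoffel D' x w - christoffel D x w in
  commutator (S (sigma x *m v)) (sigma x)
    + sigma x *m commutator (S v) (sigma x) = 0.
Proof.
move=> qD qD' eqI S.
have e := congr1 snd (eqI _ (twistor_tangent_push v)).
rewrite !I2_section_push //= in e.
have W' : endo_derivative D' sigma x v =
    endo_derivative D sigma x v + commutator (S v) (sigma x).
  exact: endo_derivativeB.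
rewrite W' in e; rewrite {1}/S commutatorB; move: e.
move: (endo_derivative D sigma x v) (commutator (S v) (sigma x)) => W C.
move: (commutator _ _) (commutator _ _) => X X'; rewrite mulmxDr.
move: (sigma x *m W) (sigma x *m C) => {}W {}C /matrixP e.
by apply/matrixP => i j; move: (e i j); rewrite !mxE => {}e; lra.
Qed.

End Basis.

Lemma covB D D' U Y x v : open U -> U x -> smooth_vf U Y ->
  cov D' Y x v - cov D Y x v = (christoffel D' x v - christoffel D x v) *m Y x.
Proof.
move=> oU Ux sY; rewrite (cov_coordE D v oU Ux sY) (cov_coordE D' v oU Ux sY).
by rewrite opprD addrACA subrr add0r mulmxBl.
Qed.

(** Test the splitting on the coordinate frame, which is a basis at [x]. *)
Lemma splitting_christoffel D D' U J1 J2 J3 S0 s1 s2 s3 x v :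
  splitting D D' U J1 J2 J3 S0 s1 s2 s3 -> U x ->
  christoffel D' x v - christoffel D x v =
    S0 x v + s1 x v *: J1 x + s2 x v *: J2 x + s3 x v *: J3 x.
Proof.
move=> spl Ux; have [_ _ _ E] := spl x v Ux.
apply/matrixP => k l.
have oa := @open_cdom _ _ M (chart_at x); have ax := chart_atP x.
have sE := smooth_vf_frame (chart_at x) l.
have := E _ _ oa ax sE; rewrite (covB D D' v oa ax sE) frame_chart_at.
by rewrite !scalemxAl -!mulmxDl -!colE => /colP /(_ k); rewrite !mxE.
Qed.

Lemma splitting_cycle D D' U J1 J2 J3 S0 s1 s2 s3 :
  splitting D D' U J1 J2 J3 S0 s1 s2 s3 ->
  splitting D D' U J2 J3 J1 S0 s2 s3 s1.
Proof.
move=> spl x v Ux; have [c1 c2 c3 E] := spl x v Ux; split=> // N Y oN Nx sY.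
rewrite (E N Y oN Nx sY) -!addrA; congr (_ + _).
by rewrite [LHS]addrC addrA.
Qed.

Lemma I2_splitting_relation D D' U J1 J2 J3 S0 s1 s2 s3 x v : (0 < m)%N ->
  quaternionic Q D -> quaternionic Q D' -> admissible_basis Q U J1 J2 J3 ->
  splitting D D' U J1 J2 J3 S0 s1 s2 s3 -> U x ->
  (forall J, twistor Q x J -> forall xi, twistor_tangent Q x J xi ->
     I2 Q D x J xi = I2 Q D' x J xi) ->
  s2 x (J1 x *m v) = s3 x v /\ s3 x (J1 x *m v) = - s2 x v.
Proof.
move=> m0 qD qD' adm spl Ux eqI.
have q y (Uy : U y) := admissible_triple adm Uy.
have s_J1 := admissible_section1 adm.
have sq y : U y -> J1 y *m J1 y = - 1%:M by move=> /q [].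
have tw : twistor Q x (J1 x) by split; [exact: s_J1.2|exact: sq].
have [c1 _ _ _] := spl x v Ux; have [c1' _ _ _] := spl x (J1 x *m v) Ux.
have := I2_relation adm s_J1 sq Ux v qD qD' (eqI _ tw).
rewrite /= !(splitting_christoffel _ spl Ux).
exact: quaternion_relation m0 (q x Ux) c1 c1'.
Qed.

(** The commutator of the difference with a section of [Q] is the difference of
    its two covariant derivatives, and both lie in [Q]; so the algebraic
    splitting exists at each point and for each vector. *)
Lemma exists_splitting D D' U J1 J2 J3 :
  quaternionic Q D -> quaternionic Q D' -> admissible_basis Q U J1 J2 J3 ->
  exists S0 s1 s2 s3, splitting D D' U J1 J2 J3 S0 s1 s2 s3.
Proof.
move=> qD qD' adm; have [oU _ _ _ _] := adm.
have span J y v : U y -> section_of Q U J ->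
    quaternion_span (J1 y) (J2 y) (J3 y)
      (commutator (christoffel D' y v - christoffel D y v) (J y)).
  move=> Uy sJ; have [B cB QB] := qD U J oU sJ y v Uy.
  have [B' cB' QB'] := qD' U J oU sJ y v Uy.
  have BE := (cov_endoP D v B oU Uy sJ.1).1 cB.
  have BE' := (cov_endoP D' v B' oU Uy sJ.1).1 cB'.
  have -> : commutator (christoffel D' y v - christoffel D y v) (J y) = B' - B.
    by rewrite BE BE' (endo_derivativeB D D') [RHS]addrAC subrr add0r.
  move: QB QB'; rewrite (admissible_span adm Uy) => -[a [b [c ->]]] [a' [b' [c' ->]]].
  exists (a' - a), (b' - b), (c' - c).
  by apply/matrixP => i j; rewrite !mxE; ring.
have s1 := admissible_section1 adm.
have s2 := admissible_section1 (admissible_cycle adm).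
have s3 := admissible_section1 (admissible_cycle (admissible_cycle adm)).
have P (yv : M * 'cV[R]_m) : exists f : 'M[R]_m * (R * R * R), U yv.1 ->
    [/\ f.1 *m J1 yv.1 = J1 yv.1 *m f.1, f.1 *m J2 yv.1 = J2 yv.1 *m f.1,
        f.1 *m J3 yv.1 = J3 yv.1 *m f.1 &
        christoffel D' yv.1 yv.2 - christoffel D yv.1 yv.2 =
          f.1 + f.2.1.1 *: J1 yv.1 + f.2.1.2 *: J2 yv.1 + f.2.2 *: J3 yv.1].
  case: yv => y v /=; have [Uy|nUy] := pselect (U y); last by exists (0, (0, 0, 0)).
  have [S0 [a [b [c H]]]] := quaternion_splitting (admissible_triple adm Uy)
    (span J1 y v Uy s1) (span J2 y v Uy s2) (span J3 y v Uy s3).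
  by exists (S0, (a, b, c)).
have [f fP] := choice P.
exists (fun y v => (f (y, v)).1), (fun y v => (f (y, v)).2.1.1),
  (fun y v => (f (y, v)).2.1.2), (fun y v => (f (y, v)).2.2).
move=> y v Uy; have [c1 c2 c3 E] := fP (y, v) Uy; split=> // N Y oN Ny sY.
by rewrite (covB D D' v oN Ny sY) E /= !mulmxDl -!scalemxAl.
Qed.

(** When the difference commutes with [J], a section through [J] has the same
    derivatives for both connections. *)
Lemma horizontal_eq D D' x J :
  (forall v, commutator (christoffel D' x v - christoffel D x v) J = 0) ->
  horizontal Q D x J = horizontal Q D' x J.
Proof.
move=> comm0.
have same sigma v : sigma x = J ->
    endo_derivative D' sigma x v = endo_derivative D sigma x v.
  move=> sx; rewrite (endo_derivativeB D D') sx.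
  by rewrite -[X in _ + X]/(commutator _ _) comm0 addr0.
apply/seteqP; split=> xi [U [sigma [[oU Ux] ssig sx cov0 xiE]]];
  exists U, sigma; split=> //.
- apply/(cov_endoP D' _ 0 oU Ux ssig.1); rewrite same //.
  exact/(cov_endoP D _ 0 oU Ux ssig.1).
- apply/(cov_endoP D _ 0 oU Ux ssig.1); rewrite -same //.
  exact/(cov_endoP D' _ 0 oU Ux ssig.1).
Qed.

End Twistor.

Theorem corollary3p2 (R : realType) (n : nat) (hn : (0 < n)%N)
    (M : manifold R (4 * n)%N) (Q : endo_family M)
    (hQ : almost_quaternionic Q)
    (D D' : connection M)
    (hD : quaternionic Q D) (hD' : quaternionic Q D')
    (hdiff : connections_differ D D') :
  (forall (x : M) (J : 'M[R]_(4 * n)%N), twistor Q x J ->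
     forall xi, twistor_tangent Q x J xi ->
       I2 Q D x J xi = I2 Q D' x J xi)
  <->
  (forall (U : set M) (J1 J2 J3 : M -> 'M[R]_(4 * n)%N),
     admissible_basis Q U J1 J2 J3 ->
     forall (S0 : M -> 'cV[R]_(4 * n)%N -> 'M[R]_(4 * n)%N)
            (s1 s2 s3 : M -> 'cV[R]_(4 * n)%N -> R),
       splitting D D' U J1 J2 J3 S0 s1 s2 s3 ->
       forall x v, U x ->
         [/\ s1 x v = 0%R, s2 x v = 0%R & s3 x v = 0%R]).
Proof.
split=> [eqI U J1 J2 J3 adm S0 s1 s2 s3 spl x v Ux|vanish x J [QJ _] xi _].
  have m0 : (0 < 4 * n)%N by rewrite muln_gt0.
  have rel1 w := I2_splitting_relation w m0 hD hD' adm spl Ux (eqI x).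
  have rel2 w := I2_splitting_relation w m0 hD hD' (admissible_cycle adm)
    (splitting_cycle spl) Ux (eqI x).
  have rel3 w := I2_splitting_relation w m0 hD hD'
    (admissible_cycle (admissible_cycle adm))
    (splitting_cycle (splitting_cycle spl)) Ux (eqI x).
  have [_ _ _ J12 _] := admissible_triple adm Ux.
  have s1_0 w : s1 x w = 0.
    (* [s1 w = s3 (J2 w) = s2 (J1 J2 w) = s2 (J3 w) = - s1 w] *)
    have [e3 _] := rel2 w; have [e2 _] := rel1 (J2 x *m w).
    have [_ e1] := rel3 w.
    by rewrite mulmxA J12 e3 e1 in e2; lra.
  have s2_0 w : s2 x w = 0 by have [<- _] := rel3 w; exact: s1_0.
  by split=> //; have [<- _] := rel1 v; exact: s2_0.
have [U [J1 [J2 [J3 [Ux adm]]]]] := hQ x.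
have [S0 [s1 [s2 [s3 spl]]]] := exists_splitting hD hD' adm.
have comm0 v : commutator (christoffel D' x v - christoffel D x v) J = 0.
  have [e1 e2 e3] := vanish U J1 J2 J3 adm S0 s1 s2 s3 spl x v Ux.
  have [c1 c2 c3 _] := spl x v Ux.
  rewrite (splitting_christoffel v spl Ux) e1 e2 e3 !scale0r !addr0.
  move: QJ; rewrite (admissible_span adm Ux) => -[a [b [c ->]]].
  rewrite /commutator !mulmxDr !mulmxDl -!scalemxAl -!scalemxAr.
  by rewrite c1 c2 c3 subrr.
by rewrite /I2 /hlift (horizontal_eq Q comm0).
Qed.
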